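(* Let $h : [0,1] \to \mathbb{R}$ be the binary entropy function (with natural logarithm), and let $\phi = \frac{\sqrt{5}+1}{2}$ be the golden ratio. If $x$ is a real number with $0 \le x \le 1$, then \[ h(x^2) \ge \phi\, x\, h(x). \]
   Context: The binary entropy function $h$ is defined on the interval $[0,1]$ by \[ h(x) = \begin{cases} -x \log x - (1 - x) \log(1 - x) & \text{if } 0 < x < 1, \\ 0 & \text{if } x = 0 \text{ or } x = 1, \end{cases} \] where $\log$ denotes the natural logarithm (base $e$). *)

(* Defs.v *)
From Stdlib Require Import Reals.
Open Scope R_scope.

(** Binary entropy, [ln] being the natural logarithm. It is only meaningful on
    [[0, 1]]; the [else] branches give the value at the endpoints [0] and [1], and
    the junk value [0] outside the unit interval. *)
Definition binary_entropy (x : R) : R :=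
  if Rlt_dec 0 x then
    if Rlt_dec x 1 then - x * ln x - (1 - x) * ln (1 - x) else 0
  else 0.

Definition golden_ratio : R := (sqrt 5 + 1) / 2.

(* Main.v *)
Require Import Defs.
From Stdlib Require Import Reals Lra.
From Coquelicot Require Import Coquelicot.
Open Scope R_scope.

(** Let [G x = h (x ^ 2) - phi x h x], called [gap] below, and let
    [q = phi - 1 = 1 / phi], so that [q ^ 2 = 1 - q].  The inequality is tight at
    the points [0], [q] and [1], with a double contact at [0] and at [q]: at [q]
    because [h (q ^ 2) = h (1 - q) = h q] and [phi q = 1].  These five zeros,
    counted with multiplicity, leave no room for a sign change of [G].

    Indeed the logarithms disappear after three differentiations, and
    [G''' x * (x (1 + x) ^ 2 (1 - x) ^ 2)] is a polynomial that is concave on the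
    positive reals ([gap3_mul]).  Hence the points where [G'''] is positive form
    an interval: on [(0, 1)] it never has the sign pattern [+ - +]
    ([gap3_sign]).  On the other hand, if [G] were negative somewhere, repeated
    use of the mean value theorem between the known zeros, together with
    [G'' q > 0] ([gap2_q]), would produce exactly that pattern.  This sign count
    is [nonneg_of_third_derivative_sign]; it holds for arbitrary functions with such zeros.

    All functions are written with [xlnx x = x ln x], whose continuity at [0]
    takes care of the endpoints. *)

(** * The sign count *)

(** The open interval for [c] matters: the strict inequalities between successive
    intermediate points come from it. *)
Lemma mean_value (f f' : R -> R) (a b : R) :
  a < b ->
  (forall x, a < x < b -> is_derive f x (f' x)) ->
  (forall x, a <= x <= b -> continuity_pt f x) ->
  exists c, a < c < b /\ f b - f a = f' c * (b - a).
Proof.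
  intros Hab Hd Hc.
  assert (pr : forall c, a < c < b -> derivable_pt f c).
  { intros c H; exists (f' c); apply is_derive_Reals, Hd, H. }
  destruct (MVT f id a b pr (fun c _ => derivable_pt_id c) Hab Hc
              (fun c _ => derivable_continuous_pt _ _ (derivable_pt_id c)))
    as [c [P E]].
  exists c; split; [exact P|].
  replace (derive_pt f c (pr c P)) with (f' c) in E.
  - rewrite derive_pt_id in E; unfold id in E; lra.
  - symmetry; apply derive_pt_eq_0, is_derive_Reals, Hd, P.
Qed.

Lemma is_derive_continuity_pt (f : R -> R) (x l : R) :
  is_derive f x l -> continuity_pt f x.
Proof.
  intros H; apply derivable_continuous_pt; exists l.
  now apply is_derive_Reals.
Qed.

Lemma exists_derive_neg (f f' : R -> R) (a b : R) :
  a < b -> f b < f a ->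
  (forall x, a < x < b -> is_derive f x (f' x)) ->
  (forall x, a <= x <= b -> continuity_pt f x) ->
  exists c, a < c < b /\ f' c < 0.
Proof.
  intros Hab Hf Hd Hc.
  destruct (mean_value f f' a b Hab Hd Hc) as [c [P E]].
  exists c; split; [exact P|nra].
Qed.

Lemma exists_derive_pos (f f' : R -> R) (a b : R) :
  a < b -> f a < f b ->
  (forall x, a < x < b -> is_derive f x (f' x)) ->
  (forall x, a <= x <= b -> continuity_pt f x) ->
  exists c, a < c < b /\ 0 < f' c.
Proof.
  intros Hab Hf Hd Hc.
  destruct (mean_value f f' a b Hab Hd Hc) as [c [P E]].
  exists c; split; [exact P|nra].
Qed.

Lemma exists_derive_zero (f f' : R -> R) (a b : R) :
  a < b -> f a = f b ->
  (forall x, a < x < b -> is_derive f x (f' x)) ->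
  (forall x, a <= x <= b -> continuity_pt f x) ->
  exists c, a < c < b /\ f' c = 0.
Proof.
  intros Hab Hf Hd Hc.
  destruct (mean_value f f' a b Hab Hd Hc) as [c [P E]].
  exists c; split; [exact P|].
  apply Rmult_eq_reg_r with (b - a); lra.
Qed.

(** A function with a double zero at [a], a strict local minimum of value [0] at
    [q] and a zero at [b] can only be negative at a point [p] if its derivatives
    oscillate more than the last hypothesis allows.  For [p < q], the values
    [0, f p, 0] make [f1] negative and then positive between zeros at [a] and [q],
    so [f2] takes the signs [- + -] before the positive value at [q], and [f3] the
    signs [+ - +].  For [q < p], the same reasoning on [[q, b]] only yields [- +]
    for [f3]; the missing first sign comes from [[a, q]], where Rolle's theorem
    gives a zero of [f2] before its positive value at [q]. *)
Lemma nonneg_of_third_derivative_sign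
  (f f1 f2 f3 : R -> R) (a q b : R) :
  a < q < b ->
  (forall x, a < x < b -> is_derive f x (f1 x)) ->
  (forall x, a < x < b -> is_derive f1 x (f2 x)) ->
  (forall x, a < x < b -> is_derive f2 x (f3 x)) ->
  (forall x, a <= x <= b -> continuity_pt f x) ->
  continuity_pt f1 a ->
  f a = 0 -> f q = 0 -> f b = 0 ->
  f1 a = 0 -> f1 q = 0 -> 0 < f2 q ->
  (forall y1 y2 y3, a < y1 -> y1 < y2 -> y2 < y3 -> y3 < b ->
     0 < f3 y1 -> 0 < f3 y3 -> 0 <= f3 y2) ->
  forall x, a <= x <= b -> 0 <= f x.
Proof.
  intros [Haq Hqb] D0 D1 D2 C0 C1a Fa Fq Fb F1a F1q F2q S p Hp.
  assert (C1 : forall x, a <= x < b -> continuity_pt f1 x).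
  { intros x Hx; destruct (Req_dec x a) as [->|Hxa]; [exact C1a|].
    apply (is_derive_continuity_pt _ _ (f2 x)), D1; lra. }
  assert (C2 : forall x, a < x < b -> continuity_pt f2 x).
  { intros x Hx; apply (is_derive_continuity_pt _ _ (f3 x)), D2; lra. }
  destruct (Rle_lt_dec 0 (f p)) as [H|Fp]; [exact H|exfalso].
  assert (p <> a) by (intros ->; lra).
  assert (p <> q) by (intros ->; lra).
  assert (p <> b) by (intros ->; lra).
  assert (M0n : forall s t, a <= s -> s < t -> t <= b -> f t < f s ->
            exists c, s < c < t /\ f1 c < 0).
  { intros s t Hs Hst Ht Hf; apply (exists_derive_neg f); auto.
    - intros; apply D0; lra.
    - intros; apply C0; lra. }
  assert (M0p : forall s t, a <= s -> s < t -> t <= b -> f s < f t ->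
            exists c, s < c < t /\ 0 < f1 c).
  { intros s t Hs Hst Ht Hf; apply (exists_derive_pos f); auto.
    - intros; apply D0; lra.
    - intros; apply C0; lra. }
  assert (M1n : forall s t, a <= s -> s < t -> t < b -> f1 t < f1 s ->
            exists c, s < c < t /\ f2 c < 0).
  { intros s t Hs Hst Ht Hf; apply (exists_derive_neg f1); auto.
    - intros; apply D1; lra.
    - intros; apply C1; lra. }
  assert (M1p : forall s t, a <= s -> s < t -> t < b -> f1 s < f1 t ->
            exists c, s < c < t /\ 0 < f2 c).
  { intros s t Hs Hst Ht Hf; apply (exists_derive_pos f1); auto.
    - intros; apply D1; lra.
    - intros; apply C1; lra. }
  assert (M2n : forall s t, a < s -> s < t -> t < b -> f2 t < f2 s ->
            exists c, s < c < t /\ f3 c < 0).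
  { intros s t Hs Hst Ht Hf; apply (exists_derive_neg f2); auto.
    - intros; apply D2; lra.
    - intros; apply C2; lra. }
  assert (M2p : forall s t, a < s -> s < t -> t < b -> f2 s < f2 t ->
            exists c, s < c < t /\ 0 < f3 c).
  { intros s t Hs Hst Ht Hf; apply (exists_derive_pos f2); auto.
    - intros; apply D2; lra.
    - intros; apply C2; lra. }
  destruct (Rlt_le_dec p q) as [Hpq|Hpq].
  - destruct (M0n a p) as [s1 [? ?]]; try lra.
    destruct (M0p p q) as [s2 [? ?]]; try lra.
    destruct (M1n a s1) as [t1 [? ?]]; try lra.
    destruct (M1p s1 s2) as [t2 [? ?]]; try lra.
    destruct (M1n s2 q) as [t3 [? ?]]; try lra.
    destruct (M2p t1 t2) as [y1 [? ?]]; try lra.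
    destruct (M2n t2 t3) as [y2 [? ?]]; try lra.
    destruct (M2p t3 q) as [y3 [? ?]]; try lra.
    specialize (S y1 y2 y3); lra.
  - destruct (exists_derive_zero f f1 a q) as [s0 [? ?]]; try lra.
    { intros; apply D0; lra. }
    { intros; apply C0; lra. }
    destruct (exists_derive_zero f1 f2 s0 q) as [t0 [? ?]]; try lra.
    { intros; apply D1; lra. }
    { intros; apply C1; lra. }
    destruct (M0n q p) as [s1 [? ?]]; try lra.
    destruct (M0p p b) as [s2 [? ?]]; try lra.
    destruct (M1n q s1) as [t1 [? ?]]; try lra.
    destruct (M1p s1 s2) as [t2 [? ?]]; try lra.
    destruct (M2p t0 q) as [y1 [? ?]]; try lra.
    destruct (M2n q t1) as [y2 [? ?]]; try lra.
    destruct (M2p t1 t2) as [y3 [? ?]]; try lra.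
    specialize (S y1 y2 y3); lra.
Qed.

(** * Continuity of [x ln x] at the origin *)

Definition xlnx (x : R) : R := x * ln x.

Lemma is_derive_xlnx (x : R) : 0 < x -> is_derive xlnx x (ln x + 1).
Proof.
  intros Hx; unfold xlnx; auto_derive; [exact Hx|field; lra].
Qed.

Lemma xlnx_0 : xlnx 0 = 0.
Proof. unfold xlnx; ring. Qed.

Lemma xlnx_1 : xlnx 1 = 0.
Proof. unfold xlnx; rewrite ln_1; ring. Qed.

(** For [0 < x], the bound is [- ln s <= 1 / s] at [s = sqrt x]; for [x <= 0]
    both sides vanish, as [ln] and [sqrt] are [0] there.  Covering negative [x]
    yields two-sided continuity at [0]. *)
Lemma Rabs_xlnx_le (x : R) : x <= 1 -> Rabs (xlnx x) <= 2 * sqrt x.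
Proof.
  intros Hx; unfold xlnx.
  destruct (Rlt_le_dec 0 x) as [H0|H0].
  - assert (Hs : 0 < sqrt x) by now apply sqrt_lt_R0.
    assert (Hl : ln x = 2 * ln (sqrt x)).
    { rewrite <- (sqrt_sqrt x) at 1 by lra; rewrite ln_mult by lra; ring. }
    assert (Hn : ln x <= 0) by (rewrite <- ln_1; apply ln_le; lra).
    assert (Hi : - ln (sqrt x) <= / sqrt x).
    { rewrite <- ln_Rinv by exact Hs.
      left; apply exp_lt_inv; rewrite exp_ln by now apply Rinv_0_lt_compat.
      generalize (exp_ineq1_le (/ sqrt x)); lra. }
    rewrite Rabs_left1 by nra.
    assert (E : sqrt x * / sqrt x = 1) by (field; lra).
    assert (E' : sqrt x * sqrt x = x) by (apply sqrt_sqrt; lra).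
    rewrite Hl, <- E' at 1. nra.
  - rewrite (sqrt_neg_0 x H0).
    replace (ln x) with 0.
    + rewrite Rmult_0_r, Rabs_R0; lra.
    + unfold ln; destruct (Rlt_dec 0 x); [exfalso; lra|reflexivity].
Qed.

Lemma continuity_pt_xlnx (x : R) : 0 <= x -> continuity_pt xlnx x.
Proof.
  intros [Hx|<-].
  - now apply is_derive_continuity_pt with (ln x + 1), is_derive_xlnx.
  - intros e He.
    (* the bound [2 * sqrt y] is below [e] as soon as [y < (e / 2) ^ 2] *)
    exists (Rmin 1 ((e / 2) ^ 2)); split.
    + apply Rmin_pos; [lra|apply pow_lt; lra].
    + intros y [_ Hy]; simpl in *; unfold Rdist in *.
      rewrite xlnx_0, Rminus_0_r in *.
      apply Rabs_def2 in Hy.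
      generalize (Rmin_l 1 ((e/2)*((e/2)*1))) (Rmin_r 1 ((e/2)*((e/2)*1))); intros.
      eapply Rle_lt_trans; [apply Rabs_xlnx_le; lra|].
      enough (sqrt y < e / 2) by lra.
      rewrite <- (sqrt_square (e / 2)) by lra.
      destruct (Rle_lt_dec y 0).
      * rewrite (sqrt_neg_0 y) by lra; apply sqrt_lt_R0; nra.
      * apply sqrt_lt_1; nra.
Qed.

(** * The golden ratio and its inverse *)

Lemma golden_ratio_bounds : 1 < golden_ratio < 2.
Proof.
  assert (2 < sqrt 5 < 3); [|unfold golden_ratio; lra].
  split; apply Rsqr_incrst_0; try lra; try apply sqrt_pos;
  rewrite Rsqr_sqrt; unfold Rsqr; lra.
Qed.

Lemma golden_ratio_sqr : golden_ratio * golden_ratio = golden_ratio + 1.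
Proof.
  unfold golden_ratio.
  assert (sqrt 5 * sqrt 5 = 5) by (apply sqrt_sqrt; lra).
  nra.
Qed.

(** Subtracting [1] inverts, because [phi ^ 2 = phi + 1]. *)
Definition golden_inverse : R := golden_ratio - 1.
Local Notation q := golden_inverse.

Lemma golden_inverse_sqr : q * q = 1 - q.
Proof. unfold q. generalize golden_ratio_sqr. nra. Qed.

Lemma golden_inverse_bounds : 3 / 5 < q < 5 / 8.
Proof.
  generalize golden_inverse_sqr golden_ratio_bounds; unfold q; nra.
Qed.

Lemma ln_1_minus_q : ln (1 - q) = 2 * ln q.
Proof.
  generalize golden_inverse_bounds; intros.
  rewrite <- golden_inverse_sqr, ln_mult; lra.
Qed.

Lemma ln_1_plus_q : ln (1 + q) = - ln q.
Proof.
  generalize golden_inverse_bounds golden_inverse_sqr; intros.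
  rewrite <- ln_Rinv by lra; f_equal.
  apply Rmult_eq_reg_l with q; [|lra].
  rewrite Rinv_r by lra; lra.
Qed.

(** [gap2_q] needs [- ln q > (1 + 2 q) / (4 + 2 q) = 0.4270...], while
    [- ln q = 0.4812...].  Since [exp 1 <= 3], it is enough that
    [q ^ 7 * 3 ^ 3 <= 1], which gives the bound [3 / 7 = 0.4285...]. *)
Lemma ln_golden_inverse_le : ln q <= - (3 / 7).
Proof.
  generalize golden_inverse_bounds golden_inverse_sqr; intros B E.
  assert (H : 7 * ln q + 3 <= 0); [|lra].
  assert (Hq : q ^ 7 = 13 * q - 8).
  { replace (q ^ 7) with ((q * q) * (q * q) * (q * q) * q) by ring.
    rewrite E; replace ((1 - q) * (1 - q)) with (1 - 2 * q + q * q) by ring.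
    rewrite E. nra. }
  assert (P : ln (q ^ 7) = 7 * ln q) by (rewrite ln_pow by lra; simpl; ring).
  assert (P3 : 3 <= ln (3 ^ 3)).
  { rewrite ln_pow by lra.
    enough (1 <= ln 3) by (simpl; lra).
    rewrite <- (ln_exp 1); apply ln_le; [apply exp_pos|apply exp_le_3]. }
  assert (0 < q ^ 7) by (apply pow_lt; lra).
  assert (Hm : ln (q ^ 7 * 3 ^ 3) <= 0).
  { rewrite <- ln_1; apply ln_le; [apply Rmult_lt_0_compat; lra|].
    rewrite Hq; nra. }
  rewrite ln_mult in Hm by lra. lra.
Qed.

(** * The gap and its derivatives *)

(** On [(0, 1)] this is [h (x ^ 2) - phi x h x] ([gap_eq]), after expanding
    [ln (1 - x ^ 2) = ln (1 + x) + ln (1 - x)].  In this form it is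
    continuous up to both endpoints. *)
Definition gap (x : R) : R :=
  - (1 - q) * x * xlnx x - (1 - x) * xlnx (1 + x) - (1 - q * x) * xlnx (1 - x).

Definition gap1 (x : R) : R :=
  - (1 - q) * (2 * xlnx x + x) + xlnx (1 + x) - (1 - x) * (ln (1 + x) + 1)
  + q * xlnx (1 - x) + (1 - q * x) * (ln (1 - x) + 1).

Definition gap2 (x : R) : R :=
  - (1 - q) * (2 * ln x + 3) + (2 * ln (1 + x) + 3) - 2 / (1 + x)
  - q * (2 * ln (1 - x) + 3) - (1 - q) / (1 - x).

Definition gap3 (x : R) : R :=
  - 2 * (1 - q) / x + 2 / (1 + x) + 2 / (1 + x) ^ 2
  + 2 * q / (1 - x) - (1 - q) / (1 - x) ^ 2.

Lemma is_derive_gap (x : R) : 0 < x < 1 -> is_derive gap x (gap1 x).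
Proof.
  intros Hx; unfold gap, gap1, xlnx; auto_derive; [lra|].
  unfold Rminus; field; lra.
Qed.

Lemma is_derive_gap1 (x : R) : 0 < x < 1 -> is_derive gap1 x (gap2 x).
Proof.
  intros Hx; unfold gap1, gap2, xlnx; auto_derive; [lra|].
  unfold Rminus; field; lra.
Qed.

Lemma is_derive_gap2 (x : R) : 0 < x < 1 -> is_derive gap2 x (gap3 x).
Proof.
  intros Hx; unfold gap2, gap3; auto_derive; [lra|].
  unfold Rminus; field; lra.
Qed.

Lemma continuity_pt_comp_xlnx (g : R -> R) (x : R) :
  continuity_pt g x -> 0 <= g x -> continuity_pt (fun t => xlnx (g t)) x.
Proof.
  intros Hg H; apply (continuity_pt_comp g xlnx); auto using continuity_pt_xlnx.
Qed.

Lemma continuity_pt_gap (x : R) : 0 <= x <= 1 -> continuity_pt gap x.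
Proof.
  intros Hx; unfold gap.
  assert (continuity_pt xlnx x) by (apply continuity_pt_xlnx; lra).
  assert (continuity_pt (fun t => xlnx (1 + t)) x)
    by (apply continuity_pt_comp_xlnx; [reg|lra]).
  assert (continuity_pt (fun t => xlnx (1 - t)) x)
    by (apply continuity_pt_comp_xlnx; [reg|lra]).
  apply continuity_pt_minus; [apply continuity_pt_minus|];
    (apply continuity_pt_mult; [reg|assumption]).
Qed.

Lemma continuity_pt_gap1_0 : continuity_pt gap1 0.
Proof.
  assert (continuity_pt xlnx 0) by (apply continuity_pt_xlnx; lra).
  (* Only [xlnx x] is singular at [0]; the other terms are differentiable. *)
  apply continuity_pt_ext with (fun x =>
    - (1 - q) * 2 * xlnx x +
    (- (1 - q) * x + xlnx (1 + x) - (1 - x) * (ln (1 + x) + 1)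
     + q * xlnx (1 - x) + (1 - q * x) * (ln (1 - x) + 1))).
  { intros x; unfold gap1; ring. }
  apply continuity_pt_plus.
  - apply continuity_pt_mult; [reg|assumption].
  - eapply is_derive_continuity_pt; unfold xlnx; auto_derive; [lra|reflexivity].
Qed.

(** At [q], all logarithms are multiples of [ln q], and [q ^ 2 = 1 - q] cancels
    their coefficients.  The same happens in [gap1_q]. *)
Lemma gap_q : gap q = 0.
Proof.
  unfold gap, xlnx; rewrite ln_1_minus_q, ln_1_plus_q.
  generalize golden_inverse_sqr (ln q); intros E l.
  transitivity (l * (1 - q) * (q * q - (1 - q))); [|rewrite E]; ring.
Qed.

Lemma gap1_q : gap1 q = 0.
Proof.
  unfold gap1, xlnx; rewrite ln_1_minus_q, ln_1_plus_q.
  generalize golden_inverse_sqr (ln q); intros E l.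
  transitivity (2 * l * ((1 - q) - q * q)); [|rewrite E]; ring.
Qed.

Lemma gap2_q : 0 < gap2 q.
Proof.
  generalize golden_inverse_bounds golden_inverse_sqr; intros B E.
  assert (H1 : 2 / (1 + q) = 2 * q).
  { apply Rmult_eq_reg_r with (1 + q); [field_simplify; nra|lra]. }
  assert (H2 : (1 - q) / (1 - q) = 1) by (field; lra).
  unfold gap2; rewrite H1, H2, ln_1_minus_q, ln_1_plus_q.
  generalize ln_golden_inverse_le; intros. nra.
Qed.

(** The coefficient of [x ^ 4] is [- 2 (1 - q) + 2 - 2 q = 0], which leaves a
    cubic; it is concave for [0 <= x], since [- 4] and [- (1 + q)] are
    negative. *)
Lemma gap3_mul (x : R) : 0 < x < 1 ->
  gap3 x * (x * (1 + x) ^ 2 * (1 - x) ^ 2)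
  = - 2 * (1 - q) + 3 * (1 + q) * x - 4 * x ^ 2 - (1 + q) * x ^ 3.
Proof.
  intros Hx; unfold gap3; field_simplify; [ring | lra ..].
Qed.

(** By [gap3_mul], [gap3] has on [(0, 1)] the sign of a concave function. *)
Lemma gap3_sign (y1 y2 y3 : R) :
  0 < y1 -> y1 < y2 -> y2 < y3 -> y3 < 1 ->
  0 < gap3 y1 -> 0 < gap3 y3 -> 0 <= gap3 y2.
Proof.
  intros H1 H12 H23 H3 P1 P3.
  set (w := fun x => x * (1 + x) ^ 2 * (1 - x) ^ 2).
  assert (W : forall x, 0 < x < 1 -> 0 < w x).
  { intros x Hx; unfold w.
    repeat apply Rmult_lt_0_compat; try apply pow_lt; lra. }
  assert (N1 := Rmult_lt_0_compat _ _ P1 (W y1 ltac:(lra))).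
  assert (N3 := Rmult_lt_0_compat _ _ P3 (W y3 ltac:(lra))).
  assert (N2 : 0 <= gap3 y2 * w y2).
  { unfold w in *; rewrite gap3_mul in * by lra.
    apply Rmult_le_reg_r with (y3 - y1); [lra|].
    (* For [N x = c0 + c1 x - 4 x ^ 2 - (1 + q) x ^ 3], the difference
       [(y3 - y1) N y2 - (y3 - y2) N y1 - (y2 - y1) N y3] is the product below. *)
    generalize golden_inverse_bounds; intros B.
    assert (0 <= (y3 - y1) * (y3 - y2) * (y2 - y1)
                 * (4 + (1 + q) * (y1 + y2 + y3))).
    { repeat apply Rmult_le_pos; nra. }
    assert (N1' := Rmult_lt_0_compat _ (y3 - y2) N1 ltac:(lra)).
    assert (N3' := Rmult_lt_0_compat _ (y2 - y1) N3 ltac:(lra)).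
    lra. }
  assert (W2 := W y2 ltac:(lra)). nra.
Qed.

(** * The inequality *)

Lemma gap_nonneg (x : R) : 0 <= x <= 1 -> 0 <= gap x.
Proof.
  generalize golden_inverse_bounds; intros B.
  apply nonneg_of_third_derivative_sign with gap1 gap2 gap3 q.
  - lra.
  - exact is_derive_gap.
  - exact is_derive_gap1.
  - exact is_derive_gap2.
  - exact continuity_pt_gap.
  - exact continuity_pt_gap1_0.
  - unfold gap; rewrite Rplus_0_r, Rminus_0_r, xlnx_1; ring.
  - exact gap_q.
  - unfold gap; rewrite (Rminus_diag 1), xlnx_0, xlnx_1; ring.
  - unfold gap1; rewrite !Rplus_0_r, Rminus_0_r, xlnx_0, xlnx_1, ln_1; ring.
  - exact gap1_q.
  - exact gap2_q.
  - exact gap3_sign.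
Qed.

Lemma gap_eq (x : R) : 0 < x < 1 ->
  gap x = binary_entropy (x ^ 2) - golden_ratio * x * binary_entropy x.
Proof.
  intros Hx; unfold binary_entropy.
  destruct (Rlt_dec 0 x); [|lra]; destruct (Rlt_dec x 1); [|lra].
  destruct (Rlt_dec 0 (x ^ 2)); [|nra]; destruct (Rlt_dec (x ^ 2) 1); [|nra].
  replace (1 - x ^ 2) with ((1 + x) * (1 - x)) by ring.
  rewrite ln_mult, ln_pow by lra.
  unfold gap, xlnx, q; simpl INR; ring.
Qed.

Theorem mainTheorem1 (x : R) (hx : 0 <= x <= 1) :
  binary_entropy (x ^ 2) >= golden_ratio * x * binary_entropy x.
Proof.
  destruct (Req_dec x 0) as [->|H0].
  { rewrite pow_i by auto; unfold binary_entropy.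
    destruct (Rlt_dec 0 0); lra. }
  destruct (Req_dec x 1) as [->|H1].
  { rewrite pow1; unfold binary_entropy.
    destruct (Rlt_dec 0 1), (Rlt_dec 1 1); lra. }
  generalize (gap_nonneg x hx); rewrite gap_eq by lra; lra.
Qed.
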